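(* Let $(X_n)_{n\ge 0}$ be the self-interacting nearest-neighbour random walk on $\mathbb{Z}$ with $X_0=0$, initial local time profile $L_0\equiv 0$, and transition rule $$P(X_{n+1}=X_n+1\mid X_0,\dots,X_n)=1-P(X_{n+1}=X_n-1\mid X_0,\dots,X_n)=\frac{e^{-\Delta^\#_n}}{e^{\Delta^\#_n}+e^{-\Delta^\#_n}},$$ where $$\Delta^\#_n=2\ell_n(-3/2)-\ell_n(-1/2)-\ell_n(1/2)$$ and $\ell_n(e)=L_n(X_n+e)$ is the local time profile on edges seen from the walker at time $n$. Then with positive probability $X_n\sim(\log n)/(\log 2)$ as $n\to\infty$, i.e. $$P\Big(\lim_{n\to\infty}\frac{X_n\,\log 2}{\log n}=1\Big)>0.$$
   Context: The set $E$ of unoriented edges of $\mathbb{Z}$ is identified with $\mathbb{Z}+1/2$: the edge $\{x,x+1\}$ corresponds to $x+1/2$. Given an initial profile $L_0:E\to\mathbb{R}$, the local time profile is updated by $L_{n+1}(e)=L_n(e)+1_{\{e=e_{n+1}\}}$, where $e_{n+1}=\{X_n,X_{n+1}\}$ is the edge crossed at the $(n+1)$-th jump. Thus, when $L_0\equiv0$, $L_n(e)$ is the number of times the walk has crossed the edge $e$ (in either direction) during its first $n$ steps. *)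

(* Defs.v *)
From HB Require Import structures.
From mathcomp Require Import all_boot all_order all_algebra.
From mathcomp Require Import all_classical all_reals all_analysis.
Import Order.TTheory GRing.Theory Num.Theory numFieldNormedType.Exports.

Set Implicit Arguments.
Unset Strict Implicit.
Unset Printing Implicit Defensive.

Local Open Scope classical_set_scope.
Local Open Scope ring_scope.

HB.instance Definition _ := isPointed.Build int 0.
HB.instance Definition _ := @isMeasurable.Build default_measure_display
  int discrete_measurable discrete_measurable0
  discrete_measurableC discrete_measurableU.

(* The edge {k, k + 1} of Z, that is the half-integer k + 1/2, is encoded by
   its left endpoint k. Since x + (k + 1/2) = (x + k) + 1/2, translating an edge
   by an integer x adds x to its code; the edges -3/2, -1/2 and 1/2 have
   codes -2, -1 and 0. *)
Notation edge := int (only parsing).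

(* The min is the left endpoint of {x_n, x_(n+1)} when these are neighbours; on
   the walks considered below this is the case almost surely. *)
Definition crossed_edge (x : nat -> int) (n : nat) : edge :=
  Num.min (x n) (x n.+1).

Fixpoint local_time (R : realType) (L0 : edge -> R) (x : nat -> int) (n : nat)
    (e : edge) : R :=
  if n is m.+1 then
    local_time L0 x m e + (e == crossed_edge x m)%:R
  else L0 e.

Definition local_time_from_walker (R : realType) (L0 : edge -> R)
    (x : nat -> int) (n : nat) (e : edge) : R :=
  local_time L0 x n (x n + e).

Definition delta_sharp (R : realType) (L0 : edge -> R) (x : nat -> int)
    (n : nat) : R :=
  let l := local_time_from_walker L0 x n in
  2 * l (- 2) - l (- 1) - l 0.

Definition right_probability (R : realType) (delta : R) : R :=
  expR (- delta) / (expR delta + expR (- delta)).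

(* Only meaningful when 0 < P B. *)
Definition cond_prob (d : measure_display) (T : measurableType d)
    (R : realType) (P : probability T R) (A B : set T) : R :=
  fine (P (A `&` B)) / fine (P B).

Definition history (T : Type) (X : nat -> T -> int) (x : nat -> int) (n : nat) :
    set T :=
  [set w | forall i, (i <= n)%N -> X i w = x i].

(* The values X_0, ..., X_n being discrete, conditioning on them is conditioning
   on each event {X_0 = x_0, ..., X_n = x_n} of positive probability. Both
   conditional probabilities are prescribed and they sum to 1, so the walk is
   almost surely nearest-neighbour. *)
Definition self_interacting_walk (d : measure_display) (T : measurableType d)
    (R : realType) (P : probability T R)
    (X : nat -> {RV P >-> int}) (L0 : edge -> R) : Prop :=
  P [set w | X 0%N w = 0] = 1%E /\
  forall (n : nat) (x : nat -> int),
    (0 < P (history X x n))%E ->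
    let p := right_probability (delta_sharp L0 x n) in
    cond_prob P [set w | X n.+1 w = x n + 1] (history X x n) = p /\
    1 - cond_prob P [set w | X n.+1 w = x n - 1] (history X x n) = p.

(* Main.v *)
Require Import Defs.
From HB Require Import structures.
From mathcomp Require Import all_boot all_order all_algebra.
From mathcomp Require Import all_classical all_reals all_analysis.
From mathcomp Require Import zify ring lra.
Import Order.TTheory GRing.Theory Num.Theory numFieldNormedType.Exports.

(* While the rightmost visited site is m, the walker stays in {m - 2, m - 1, m}.
   At m the drift is 2 L(m - 2) - L(m - 1), so the last edge {m - 1, m} has to be
   crossed about twice as often as the previous one before m + 1 is reached,
   while at m - 2 the drift pushes strongly to the right. Hence local times
   double from one edge to the next, and n is of order 2^m.
   To make this rigorous, forbid at time n every step taken against a drift of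
   size at least h_n = floor(log_2 n). Such a step has conditional probability at
   most e^(-2 h_n) <= 4 / (n + 1)^2, whose sum from time 50 on is less than 1.
   So, once the walk has started by oscillating on the edge {0, 1} up to time 49
   and reached 2 at time 50, with positive probability no forbidden step is ever
   taken; and as h_n = O(m), the permitted fluctuations are negligible with
   respect to 2^m. *)

Set Implicit Arguments.
Unset Strict Implicit.
Unset Printing Implicit Defensive.

(** * Local times near the rightmost visited site *)

Definition bump_at (F : nat -> nat) (e i : nat) : nat := F i + (i == e).

(* Here F i is the local time of the edge {i - 2, i - 1}, k + 2 is the rightmost
   visited site, and p is the walker's position at time n. The slack j + 11 in
   the two-sided bound absorbs the tolerance h_n < k + 8 of each doubling. *)
Record frontier (F : nat -> nat) (k p n : nat) : Prop := Frontier {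
  frontier_left : F 0 = 0 /\ F 1 = 0;
  frontier_right : forall i, k + 4 <= i -> F i = 0;
  frontier_doubling : forall j, j <= k ->
    32 * 2 ^ j + j + 11 <= F j.+2 /\ F j.+2 + j + 11 <= 64 * 2 ^ j;
  frontier_last : 0 < F k.+3 <= 2 * F k.+2 + k + 8 + (p == k.+2);
  frontier_site : k <= p <= k.+2;
  frontier_back : p = k -> 0 < k /\ F k.+2 <= 2 * F k.+1 + k + 8;
  frontier_time : \sum_(0 <= i < k + 4) F i = n }.

Lemma sum_bump_at F e N : e < N ->
  \sum_(0 <= i < N) bump_at F e i = (\sum_(0 <= i < N) F i).+1.
Proof.
move=> eN; rewrite /bump_at big_split /= -addn1; congr addn.
rewrite big_mkord (bigD1 (Ordinal eN)) //= eqxx big1 // => i.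
by rewrite -val_eqE /= => /negPf ->.
Qed.

(** Geometric series over the upper doubling bounds; it controls the elapsed time, which is the
    total local time. *)
Lemma frontier_sum F k N : (forall j, j <= k ->
    F j.+2 + j + 11 <= 64 * 2 ^ j) -> F 0 = 0 -> F 1 = 0 ->
  N <= k.+1 -> \sum_(0 <= i < N.+2) F i + 64 <= 64 * 2 ^ N.
Proof.
move=> Fk F0 F1; elim: N => [|N IH] Nk.
  by rewrite !big_nat_recr //= big_geq // F0 F1.
rewrite big_nat_recr //=; have := IH (ltnW Nk); have := Fk N Nk.
rewrite expnS; lia.
Qed.

(** The completed edges contribute less than [128 * 2 ^ k] by the geometric sum, and the last edge
    less than as much again by [frontier_last]. *)
Lemma frontier_time_lt F k p n : frontier F k p n -> n < 2 ^ (k + 8).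
Proof.
case=> -[F0 F1] _ dbl /andP[_ c] _ _ <-.
rewrite addn4 big_nat_recr //= expnD.
have := frontier_sum (fun j jk => (dbl j jk).2) F0 F1 (leqnn _).
rewrite (expnS 2 k); have := dbl k (leqnn k); rewrite (_ : 2 ^ 8 = 256) //; lia.
Qed.

Lemma frontier_time_ge F k p n : frontier F k p n -> 2 ^ k <= n.
Proof.
case=> _ _ dbl _ _ _ <-; rewrite addn4 big_nat_recr //= big_nat_recr //=.
have := dbl k (leqnn k); lia.
Qed.

Lemma frontier_tol F k p n : frontier F k p n -> trunc_log 2 n < k + 8.
Proof.
move=> inv; have n0 : 0 < n.
  by rewrite (leq_trans _ (frontier_time_ge inv)) ?expn_gt0.
rewrite -(ltn_exp2l _ _ (isT : 1 < 2)).
apply: leq_ltn_trans (frontier_time_lt inv).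
exact: trunc_logP.
Qed.

(** The inequality says that the drift at [p] is below the tolerance, written without subtraction.
    The frontier advances only from [p = k + 2]; otherwise a visited edge is crossed again. *)
Lemma frontier_stepr F k p n : frontier F k p n ->
  2 * F p < F p.+1 + F p.+2 + trunc_log 2 n ->
  exists k', frontier (bump_at F p.+2) k' p.+1 n.+1.
Proof.
move=> inv; have := frontier_tol inv; move: (trunc_log 2 n) => h hk.
case: inv => -[F0 F1] Fr dbl /andP[c1 c2] /andP[p1 p2] back tm fb.
case: (ltngtP p k.+2) => [pk|pk|pk]; [|lia|].
- exists k; split.
  + by rewrite /bump_at F0 F1.
  + move=> i ik; rewrite /bump_at Fr //; lia.
  + move=> j jk; have := dbl j jk; rewrite /bump_at => -[d1 d2].
    split; first lia.
    (* Among the completed edges only {k, k + 1} can be crossed, from [p = k]. There [frontier_back]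
       leaves just enough room: [k + 8], the new crossing and the slack [k + 11] add up to twice the
       slack [(k - 1) + 11] of the previous edge. *)
    case: (eqVneq j.+2 p.+2) => jp; last lia.
    have [kj kp] : k = j /\ p = j by lia.
    subst k p; case: (back erefl).
    case: j dbl d1 d2 {back jk jp c1 c2 hk fb Fr p1 p2 pk tm} => //.
    move=> j dbl d1 d2 _ b.
    have := dbl j (leqnSn _); rewrite expnS; lia.
  (* Arriving at [k + 2] from [k + 1], the drift gives no upper bound on the last edge; the extra
     unit [p == k.+2] pays for this crossing. *)
  + by rewrite /bump_at; have := dbl k (leqnn k); lia.
  + lia.
  + lia.
  + rewrite sum_bump_at ?tm //; lia.
- subst p; exists k.+1; split.
  + by rewrite /bump_at F0 F1.
  + move=> i ik; rewrite /bump_at Fr; lia.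
  (* For the newly completed edge, the permitted step gives the lower bound and [frontier_last] the
     upper one. Doubling turns the slack [k + 11] into [2 * k + 22]; at most [k + 9] is spent and
     [k + 12] is needed. *)
  + move=> j; rewrite leq_eqVlt => /orP[/eqP ->|jk].
      have := dbl k (leqnn k); have := Fr k.+4 ltac:(lia).
      rewrite /bump_at expnS; lia.
    have := dbl j jk; rewrite /bump_at; lia.
  + rewrite /bump_at Fr; lia.
  + lia.
  + rewrite /bump_at; lia.
  + rewrite sum_bump_at ?addSn; last lia.
    rewrite big_nat_recr //= tm Fr; lia.
Qed.

Lemma frontier_stepl F k p n : frontier F k p n ->
  F p.+1 + F p.+2 < 2 * F p + trunc_log 2 n ->
  exists k' q, p = q.+1 /\ frontier (bump_at F p.+1) k' q n.+1.
Proof.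
move=> inv; have := frontier_tol inv; move: (trunc_log 2 n) => h hk.
case: inv => -[F0 F1] Fr dbl /andP[c1 c2] /andP[p1 p2] back tm fb.
(* No step left from [k] is permitted: by doubling, [F k.+1 + F k.+2] exceeds [2 * F k] by more than
   the tolerance. For [k = 1] this is so because [F 1] is 0. *)
have kp : k < p.
  rewrite ltn_neqAle p1 andbT; apply/eqP => kp; subst p.
  have [k0 b] := back erefl.
  case: k {Fr p1 p2 c1 c2 tm} dbl back hk fb k0 b => // k dbl back hk fb k0 b.
  have := dbl k.+1 (leqnn _); have := dbl k (leqnSn _).
  case: k {k0} dbl back hk fb b => [|k] dbl back hk fb b.
    lia.
  have := dbl k ltac:(lia); rewrite !expnS; lia.
exists k, p.-1; split; first lia.
have [pk|pk] : p = k.+2 \/ p = k.+1 by lia.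
- subst p; split => /=.
  + by rewrite /bump_at F0 F1.
  + move=> i ik; rewrite /bump_at Fr //; lia.
  + move=> j jk; have := dbl j jk; rewrite /bump_at; lia.
  + rewrite /bump_at; lia.
  + lia.
  + lia.
  + rewrite sum_bump_at ?tm //; lia.
- subst p; have := dbl k (leqnn k) => dk.
  (* With [k = 0] the edge {-1, 0} is uncrossed and the drift at 1 is below -43, against a tolerance
     less than 8. *)
  have k0 : 0 < k.
    by case: k fb dk {Fr dbl c1 c2 p1 p2 back tm kp} hk => //=; lia.
  split => /=.
  + by rewrite /bump_at F0 F1; lia.
  + move=> i ik; rewrite /bump_at Fr //; lia.
  + move=> j jk; have := dbl j jk; rewrite /bump_at => -[d1 d2].
    split; first lia.
    case: (eqVneq j.+2 k.+2) => jp; last lia.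
    (* The permitted step bounds [F k.+2 + F k.+3], hence [F k.+2], by [2 * F k.+1] plus the
       tolerance, so the upper bound survives this crossing. *)
    have kj : k = j by lia.
    subst k.
    case: j dbl d1 d2 k0 fb hk c1 c2 {back jk jp dk kp Fr p1 p2 tm} => //.
    move=> j dbl d1 d2 _ fb hk c1 c2.
    have := dbl j (leqnSn _); rewrite expnS; lia.
  + rewrite /bump_at; lia.
  + lia.
  + rewrite /bump_at; lia.
  + rewrite sum_bump_at ?tm //; lia.
Qed.

Local Open Scope classical_set_scope.
Local Open Scope ring_scope.

(** * Deterministic paths that obey the drift *)

Definition crossings (x : nat -> int) (n : nat) (e : int) : nat :=
  (\sum_(0 <= i < n) (e == crossed_edge x i))%N.

Definition drift (x : nat -> int) (n : nat) : int :=
  2 * (crossings x n (x n - 2))%:Z - (crossings x n (x n - 1))%:Z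
    - (crossings x n (x n))%:Z.

Definition obeys_drift (x : nat -> int) (n : nat) : Prop :=
  (x n.+1 = x n + 1 /\ drift x n < (trunc_log 2 n)%:Z) \/
  (x n.+1 = x n - 1 /\ - (trunc_log 2 n)%:Z < drift x n).

(** The shift by two gives the edge {-2, -1} index 0, so that the drift at [p] reads off the entries
    [p], [p + 1] and [p + 2]. *)
Definition profile (x : nat -> int) (n i : nat) : nat :=
  crossings x n (i%:Z - 2).

(** The 49 crossings of {0, 1} lie between 43 and 53, the range required by [frontier_doubling] at
    [j = 0]; as 49 is odd, the walker is then at 1, ready to step to 2. *)
Definition start (i : nat) : int := if (i < 50)%N then (odd i)%:Z else 2.

Lemma crossingsS x n e :
  crossings x n.+1 e = (crossings x n e + (e == crossed_edge x n))%N.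
Proof. by rewrite /crossings big_nat_recr. Qed.

Lemma local_time_crossings (R : realType) x n e :
  local_time (fun=> 0 : R) x n e = (crossings x n e)%:R.
Proof.
elim: n => [|n IH] /=; first by rewrite /crossings big_geq.
by rewrite IH crossingsS natrD.
Qed.

Lemma delta_sharp_drift (R : realType) x n :
  delta_sharp (fun=> 0 : R) x n = (drift x n)%:~R.
Proof.
rewrite /delta_sharp /local_time_from_walker !local_time_crossings /drift.
by rewrite addr0 !rmorphB /= rmorphM /=.
Qed.

Lemma eq_crossings x y n e : (forall i, (i <= n)%N -> x i = y i) ->
  crossings x n e = crossings y n e.
Proof.
move=> xy; apply: eq_big_nat => i /andP[_ ilt].
by rewrite /crossed_edge !xy // ltnW.
Qed.

Lemma eq_drift x y n : (forall i, (i <= n)%N -> x i = y i) ->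
  drift x n = drift y n.
Proof. by move=> xy; rewrite /drift !(eq_crossings _ xy) !xy. Qed.

Lemma eq_obeys_drift x y n : (forall i, (i <= n.+1)%N -> x i = y i) ->
  obeys_drift x n -> obeys_drift y n.
Proof.
move=> xy; rewrite /obeys_drift.
have -> : drift x n = drift y n by apply: eq_drift => i ni; apply: xy; lia.
by rewrite !xy.
Qed.

Lemma profileS_right x n p : x n = p%:Z -> x n.+1 = x n + 1 ->
  profile x n.+1 = bump_at (profile x n) p.+2.
Proof.
move=> xp xS; apply/funext => i; rewrite /profile crossingsS /bump_at.
congr (_ + nat_of_bool _)%N; rewrite /crossed_edge xS xp; lia.
Qed.

Lemma profileS_left x n p : x n = p.+1%:Z -> x n.+1 = x n - 1 ->
  profile x n.+1 = bump_at (profile x n) p.+2.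
Proof.
move=> xp xS; apply/funext => i; rewrite /profile crossingsS /bump_at.
congr (_ + nat_of_bool _)%N; rewrite /crossed_edge xS xp; lia.
Qed.

Lemma drift_profile x n p : x n = p%:Z ->
  drift x n = 2 * (profile x n p)%:Z - (profile x n p.+1)%:Z
    - (profile x n p.+2)%:Z.
Proof.
move=> xp; rewrite /drift /profile xp.
by congr (_ - (crossings x n _)%:Z - (crossings x n _)%:Z); lia.
Qed.

Lemma crossings_start n e : (n <= 49)%N ->
  crossings start n e = (n * (e == 0))%N.
Proof.
elim: n => [|n IH] n49; first by rewrite /crossings big_geq.
rewrite crossingsS IH ?(ltnW n49) // /crossed_edge /start !ifT; [|lia|lia].
by rewrite mulSn addnC /=; case: (odd n).
Qed.

Lemma frontier_start x : (forall i, (i <= 50)%N -> x i = start i) ->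
  frontier (profile x 50) 0 2 50.
Proof.
move=> xs.
have prof i : profile x 50 i = (49 * (i == 2) + (i == 3))%N.
  rewrite /profile (eq_crossings _ xs) crossingsS crossings_start //.
  have -> : crossed_edge start 49 = 1 by [].
  by congr (_ * nat_of_bool _ + nat_of_bool _)%N; lia.
split.
- by rewrite !prof.
- by move=> i i4; rewrite prof; lia.
- by move=> j; rewrite leqn0 => /eqP ->; rewrite !prof.
- by rewrite !prof.
- by [].
- by [].
- by rewrite unlock /= !prof.
Qed.

Lemma obeys_drift_frontier x : (forall i, (i <= 50)%N -> x i = start i) ->
  (forall n, (50 <= n)%N -> obeys_drift x n) ->
  forall n, (50 <= n)%N ->
  exists k p, x n = p%:Z /\ frontier (profile x n) k p n.
Proof.
move=> xs xo; elim=> // n IH; rewrite leq_eqVlt => /orP[/eqP <-|n50].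
  by exists 0%N, 2%N; split; [rewrite xs|exact: frontier_start].
have [k [p [xp fr]]] := IH n50.
have := drift_profile xp.
case: (xo n n50) => -[xS dn] dE.
- have [|k' fr'] := frontier_stepr fr; first by lia.
  by exists k', p.+1; rewrite (profileS_right xp xS); split=> //; lia.
- have [|k' [q [pq fr']]] := frontier_stepl fr; first by lia.
  subst p; exists k', q; rewrite (profileS_left xp xS); split=> //; lia.
Qed.

(** From [2 ^ k <= n < 2 ^ (k + 8)] and [k <= x n <= k + 2], the position is within 8 of the binary
    logarithm of [n]. *)
Lemma obeys_drift_log (R : realType) x :
  (forall i, (i <= 50)%N -> x i = start i) ->
  (forall n, (50 <= n)%N -> obeys_drift x n) ->
  forall n, (50 <= n)%N -> `|(x n)%:~R * ln 2 - ln n%:R| <= 8 * ln 2 :> R.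
Proof.
move=> xs xo n n50; have [k [p [-> fr]]] := obeys_drift_frontier xs xo n50.
have ln2 : 0 < ln 2 :> R by apply: ln_gt0; lra.
have lnX m : ln (2 ^ m)%N%:R = m%:R * ln 2 :> R.
  by rewrite natrX lnXn // mulr_natl.
have n0 : 0 < n%:R :> R by rewrite ltr0n; lia.
have X0 m : 0 < (2 ^ m)%N%:R :> R by rewrite ltr0n expn_gt0.
have lb : k%:R * ln 2 <= ln n%:R :> R.
  by rewrite -lnX ler_ln ?posrE // ler_nat (frontier_time_ge fr).
have ub : ln n%:R <= (k + 8)%:R * ln 2 :> R.
  by rewrite -lnX ler_ln ?posrE // ler_nat ltnW // (frontier_time_lt fr).
case: fr => _ _ _ _ /andP[kp pk] _ _.
have {}kp : k%:R <= p%:R :> R by rewrite ler_nat.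
have {}pk : p%:R <= (k + 2)%:R :> R by rewrite ler_nat addn2.
rewrite ler_norml pmulrn; move: ub pk; rewrite !natrD => ub pk.
apply/andP; split; nra.
Qed.

Lemma cvg_log_ratio (R : realType) (u : nat -> R) (c : R) (N : nat) :
  (forall n, (N <= n)%N -> `|u n - ln n%:R| <= c) ->
  (fun n => u n / ln n%:R) @ \oo --> (1 : R).
Proof.
move=> uc; apply/cvgrPdist_le => e e0.
have ec : 0 < expR (c / e) by exact: expR_gt0.
near=> n.
have n2 : 1 < n%:R :> R by rewrite ltr1n; near: n; exact: nbhs_infty_gt.
have ln0 : 0 < ln n%:R :> R by exact: ln_gt0.
have lnc : c / e <= ln n%:R.
  rewrite -[leLHS]expRK ler_ln ?posrE //; last by rewrite (lt_trans _ n2).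
  by near: n; exact: nbhs_infty_ger.
have -> : 1 - u n / ln n%:R = - ((u n - ln n%:R) / ln n%:R).
  by field; rewrite gt_eqF.
rewrite normrN normrM normfV (gtr0_norm ln0) ler_pdivrMr //.
rewrite (le_trans (uc n _)) //; first by near: n; exact: nbhs_infty_ge.
by rewrite -ler_pdivrMl // mulrC.
Unshelve. all: by end_near. Qed.

(** * Measurability of events depending on finitely many positions *)

Definition extend (x : nat -> int) (n : nat) (z : int) (i : nat) : int :=
  if i == n then z else x i.

(** Induction on the number of coordinates: the event is a countable union, over the value [z] of
    [X n], of events in which coordinate [n] is frozen at [z]. *)
Lemma measurable_path_event d (T : measurableType d) (R : realType)
    (P : probability T R) (X : nat -> {RV P >-> int})
    (n : nat) (Q : (nat -> int) -> Prop) :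
  (forall x y, (forall i, (i < n)%N -> x i = y i) -> Q x -> Q y) ->
  measurable [set w | Q (X^~ w)].
Proof.
elim: n Q => [|n IH] Q Qe.
  have [Q0|Q0] := pselect (Q (fun=> 0)).
    rewrite (_ : mkset _ = setT) //; apply/seteqP; split=> // w _ /=.
    exact: Qe Q0.
  rewrite (_ : mkset _ = set0) //; apply/seteqP; split=> // w /= Qw.
  exact/Q0/(Qe _ _ _ Qw).
rewrite (_ : mkset _ = \bigcup_z ([set w | X n w = z] `&`
    [set w | Q (extend (X^~ w) n z)])).
  apply: countable_bigcupT_measurable => [|z]; first exact: countableP.
  apply: measurableI.
    exact: (measurable_funPTI (X n) (Y := [set z])).
  apply: (IH (fun x => Q (extend x n z))) => x y xy; apply: Qe => i iS.
  rewrite /extend; case: eqVneq => // ni; apply: xy; lia.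
have ext w i : X i w = extend (X^~ w) n (X n w) i.
  by rewrite /extend; case: eqVneq => [->|].
apply/seteqP; split => [w Qw|w [z _ [/= <-]]].
  by exists (X n w) => //; split=> //=; apply: Qe Qw => i _; exact: ext.
by apply: Qe => i _; rewrite -ext.
Qed.

Lemma measurable_history d (T : measurableType d) (R : realType)
    (P : probability T R) (X : nat -> {RV P >-> int}) x n :
  measurable (history X x n).
Proof.
apply: (@measurable_path_event _ _ _ _ X n.+1
  (fun y => forall i, (i <= n)%N -> y i = x i)) => y z yz yx i ni.
by rewrite -yz ?yx.
Qed.

Lemma measurable_obeys_drift d (T : measurableType d) (R : realType)
    (P : probability T R) (X : nat -> {RV P >-> int}) n :
  measurable [set w | obeys_drift (X^~ w) n].
Proof.
apply: (@measurable_path_event _ _ _ _ X n.+2 (obeys_drift^~ n)) => x y xy.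
by apply: eq_obeys_drift => i ni; apply: xy.
Qed.

Lemma history_extend (T : Type) (X : nat -> T -> int) x n z :
  history X (extend x n.+1 z) n.+1 = history X x n `&` [set w | X n.+1 w = z].
Proof.
apply/seteqP; split => w /=.
  move=> H; split.
    by move=> i ni; rewrite H ?(leqW ni) // /extend ifF //; lia.
  by rewrite H // /extend eqxx.
move=> [H Xz] i; rewrite /extend; case: eqVneq => [->|ni ni'] //.
apply: H; lia.
Qed.

(** * Bounds on the transition probability *)

Lemma right_probability_itv (R : realType) (t : R) :
  0 < right_probability t < 1.
Proof.
have := expR_gt0 t; have := expR_gt0 (- t); rewrite /right_probability => a b.
by apply/andP; split; [rewrite divr_gt0 // addr_gt0 | rewrite ltr_pdivrMr; lra].
Qed.

Lemma right_probability_le (R : realType) (t : R) :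
  right_probability t <= expR (- t) ^+ 2.
Proof.
rewrite /right_probability expRN; have a := expR_gt0 t.
have b : 0 < (expR t)^-1 by rewrite invr_gt0.
rewrite ler_pdivrMr ?addr_gt0 // mulrDr expr2.
have ->: (expR t)^-1 * (expR t)^-1 * expR t = (expR t)^-1.
  by rewrite mulfVK // gt_eqF.
by rewrite lerDl; do !apply: mulr_ge0 => //; exact: ltW.
Qed.

Lemma right_probabilityN (R : realType) (t : R) :
  right_probability (- t) = 1 - right_probability t.
Proof.
have a := expR_gt0 t; have b := expR_gt0 (- t).
rewrite /right_probability opprK; field.
by rewrite gt_eqF ?addr_gt0 //= addrC gt_eqF ?addr_gt0.
Qed.

Definition slip (R : realType) (n : nat) : R := 4 / n.+1%:R ^+ 2.

(** With [h = trunc_log 2 n], the inequalities [n + 1 <= 2 * 2 ^ h] and [2 <= e] give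
    [e^(-2 z) <= 4^(-h) <= 4 / (n + 1)^2]. *)
Lemma right_probability_slip (R : realType) (n : nat) (z : int) :
  (0 < n)%N -> (trunc_log 2 n)%:Z <= z -> right_probability z%:~R <= slip R n.
Proof.
move=> n0 nz; apply: le_trans (right_probability_le _) _.
have nlt : (n.+1 <= 2 * 2 ^ trunc_log 2 n)%N by rewrite -expnS trunc_log_ltn.
have e2 : 2 ^+ trunc_log 2 n <= expR z%:~R :> R.
  have -> : 2 = 1 + 1 :> R by lra.
  apply: (@le_trans _ _ (expR 1 ^+ trunc_log 2 n)).
    by rewrite lerXn2r ?nnegrE ?expR_ge0 ?addr_ge0 // expR_ge1Dx.
  by rewrite -expRM_natr mul1r ler_expR pmulrn ler_int.
have {}nlt : n.+1%:R <= 2 * expR z%:~R :> R.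
  rewrite (le_trans _ (ler_wpM2l _ e2)) // -natrX -natrM ler_nat //.
have ez := expR_gt0 (z%:~R : R).
rewrite /slip expRN ler_pdivlMr ?exprn_gt0 // exprVn ler_pdivrMl ?exprn_gt0 //.
rewrite (_ : _ * 4 = (2 * expR z%:~R) ^+ 2); last by ring.
by rewrite lerXn2r ?nnegrE // mulr_ge0 // ltW.
Qed.

(** * Real-valued probabilities *)

Lemma fine_probability_le d (T : measurableType d) (R : realType)
    (P : probability T R) A B :
  measurable A -> measurable B -> A `<=` B -> fine (P A) <= fine (P B).
Proof.
by move=> mA mB AB; rewrite fine_le ?fin_num_measure // le_measure ?inE.
Qed.

Lemma fine_probabilityD d (T : measurableType d) (R : realType)
    (P : probability T R) A B : measurable A -> measurable B ->
  fine (P (A `\` B)) = fine (P A) - fine (P (A `&` B)).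
Proof.
move=> mA mB; rewrite measureD //; last by rewrite ltey_eq fin_num_measure.
by rewrite fineB ?fin_num_measure //; exact: measurableI.
Qed.

Lemma fine_probabilityU2 d (T : measurableType d) (R : realType)
    (P : probability T R) A B : measurable A -> measurable B ->
  fine (P (A `|` B)) <= fine (P A) + fine (P B).
Proof.
move=> mA mB; rewrite -fineD ?fin_num_measure //.
rewrite fine_le ?fin_numD ?fin_num_measure ?measureU2 //; exact: measurableU.
Qed.

Lemma fine_probability_ge0 d (T : measurableType d) (R : realType)
    (P : probability T R) A : 0 <= fine (P A).
Proof. exact: fine_ge0. Qed.

(** * Positive probability of never taking a forbidden step *)

Section Walk.
Context d (T : measurableType d) (R : realType) (P : probability T R)
  (X : nat -> {RV P >-> int}) (walkX : self_interacting_walk X (fun=> 0)).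
Implicit Types (x : nat -> int) (n : nat).

Let step n z := [set w | X n.+1 w = z].
Let prob_right x n : R := right_probability (drift x n)%:~R.

Let measurable_step n z : measurable (step n z).
Proof. exact: (measurable_funPTI (X n.+1) (Y := [set z])). Qed.
Let mH x n : measurable (history X x n).
Proof. exact: measurable_history. Qed.
Let mI (A B : set T) : measurable A -> measurable B -> measurable (A `&` B).
Proof. exact: measurableI. Qed.
Let mD (A B : set T) : measurable A -> measurable B -> measurable (A `\` B).
Proof. exact: measurableD. Qed.
Let mU (A B : set T) : measurable A -> measurable B -> measurable (A `|` B).
Proof. exact: measurableU. Qed.
#[local] Hint Resolve measurable_step mH mI mD mU : core.

Lemma walk_stepE x n :
  fine (P (history X x n `&` step n (x n + 1))) =
    prob_right x n * fine (P (history X x n)) /\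
  fine (P (history X x n `&` step n (x n - 1))) =
    (1 - prob_right x n) * fine (P (history X x n)).
Proof.
have [PH|PH] := ltP 0%E (P (history X x n)).
  have [_ /(_ n x PH)] := walkX; rewrite /cond_prob delta_sharp_drift.
  rewrite ![_ `&` history _ _ _]setIC -/(prob_right x n) => -[pr pl].
  have H0 : fine (P (history X x n)) != 0.
    by rewrite fine_eq0 ?fin_num_measure // gt_eqF.
  have {}pl : 1 - prob_right x n = fine (P (history X x n `&`
      step n (x n - 1))) / fine (P (history X x n)) by rewrite -pl; ring.
  by rewrite pl -pr !mulfVK.
(* On a null history both sides vanish, so the product form holds for every path. *)
have PH0 : fine (P (history X x n)) = 0.
  by apply/eqP; rewrite fine_eq0 ?fin_num_measure // eq_le PH measure_ge0.
rewrite PH0 !mulr0; split; apply/eqP.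
all: rewrite eq_le fine_probability_ge0 andbT -PH0.
all: by apply: fine_probability_le; auto; exact: subIsetl.
Qed.

Lemma walk_nearest_neighbour x n :
  fine (P (history X x n `\` (step n (x n + 1) `|` step n (x n - 1)))) = 0.
Proof.
have [r l] := walk_stepE x n.
rewrite -setDDl fine_probabilityD //; auto.
rewrite (_ : _ `&` step n (x n - 1) = history X x n `&` step n (x n - 1)).
  by rewrite fine_probabilityD // r l; ring.
apply/seteqP; split => w [] /=; first by move=> [].
by move=> H Xw; split=> //; split=> // /=; rewrite /step /= Xw; lia.
Qed.

(** If the drift is at least the tolerance, a violation excludes the step left; if it is at most
    minus the tolerance, the step right. In between, both steps are permitted and only the null
    event of a non-neighbour jump remains. *)
Lemma walk_slip_now x n : (1 < n)%N ->
  fine (P (history X x n `\` [set w | obeys_drift (X^~ w) n])) <=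
    slip R n * fine (P (history X x n)).
Proof.
move=> n1; have [r l] := walk_stepE x n.
(* A positive tolerance ensures that the two directions are never forbidden at once. *)
have h1 : (0 < trunc_log 2 n)%N by rewrite trunc_log_gt0; lia.
have mO := measurable_obeys_drift X n.
have q0 := fine_probability_ge0 P (history X x n).
have obeyE w : history X x n w -> obeys_drift (X^~ w) n <->
    (step n (x n + 1) w /\ drift x n < (trunc_log 2 n)%:Z) \/
    (step n (x n - 1) w /\ - (trunc_log 2 n)%:Z < drift x n).
  move=> H; rewrite /obeys_drift /step /= (H n) //.
  by rewrite (eq_drift (y := x) (n := n)) // => i ni; exact: H.
have [hd|hd] := leP (trunc_log 2 n)%:Z (drift x n);
  last have [dh|dh] := leP (drift x n) (- (trunc_log 2 n)%:Z).
- apply: (@le_trans _ _ (fine (P (history X x n `\` step n (x n - 1))))).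
    apply: fine_probability_le; auto => w [H nO]; split=> // S; apply: nO.
    by apply/obeyE => //; right; split=> //; lia.
  rewrite fine_probabilityD // l -[X in X - _]mul1r -mulrBl opprB addrC subrK.
  by rewrite ler_wpM2r // /prob_right right_probability_slip //; lia.
- apply: (@le_trans _ _ (fine (P (history X x n `\` step n (x n + 1))))).
    apply: fine_probability_le; auto => w [H nO]; split=> // S; apply: nO.
    by apply/obeyE => //; left; split=> //; lia.
  rewrite fine_probabilityD // r -[X in X - _]mul1r -mulrBl.
  rewrite ler_wpM2r // /prob_right -right_probabilityN -mulrNz.
  by rewrite right_probability_slip //; lia.
- apply: (@le_trans _ _ 0); last by rewrite mulr_ge0 // divr_ge0 // exprn_ge0.
  rewrite -(walk_nearest_neighbour x n).
  apply: fine_probability_le; auto => w [H nO]; split=> // S; apply: nO.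
  by apply/obeyE => //; case: S => S; [left|right].
Qed.

(* Induction on m - n: almost surely, a history up to time n splits into its two
   nearest-neighbour continuations. *)
Lemma walk_slip x n m : (1 < n <= m)%N ->
  fine (P (history X x n `\` [set w | obeys_drift (X^~ w) m])) <=
    slip R m * fine (P (history X x n)).
Proof.
move=> /andP[n1 nm]; rewrite -(subnKC nm); move: (m - n)%N => j.
elim: j n x n1 {nm m} => [|j IH] n x n1; first by rewrite addn0 walk_slip_now.
have mO := measurable_obeys_drift X (n + j.+1).
have [r l] := walk_stepE x n.
set O := [set w | _] in mO *; set H := history X x n.
have mHn : measurable H by exact: mH.
have next z : fine (P ((H `&` step n z) `\` O)) <=
    slip R (n + j.+1) * fine (P (H `&` step n z)).
  by rewrite -history_extend /O -addSnnS; apply: IH; exact: leqW.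
apply: (@le_trans _ _ (fine (P (((H `&` step n (x n + 1)) `\` O `|`
     (H `&` step n (x n - 1)) `\` O) `|`
     H `\` (step n (x n + 1) `|` step n (x n - 1)))))).
  apply: fine_probability_le; auto 6 => w [Hw nO].
  have [U|nU] := pselect (step n (x n + 1) w); first by left; left.
  have [D|nD] := pselect (step n (x n - 1) w); first by left; right.
  by right; split=> // -[].
apply: le_trans (fine_probabilityU2 P _ _) _; auto 6.
rewrite walk_nearest_neighbour addr0.
apply: le_trans (fine_probabilityU2 P _ _) _; auto 6.
apply: le_trans (lerD (next _) (next _)) _.
by rewrite r l -mulrDr -mulrDl addrC subrK mul1r.
Qed.

(** Both transition probabilities are strictly positive, so a nearest-neighbour continuation keeps
    positive mass. *)
Lemma walk_follow x n : 0 < fine (P (history X x n)) ->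
  x n.+1 = x n + 1 \/ x n.+1 = x n - 1 -> 0 < fine (P (history X x n.+1)).
Proof.
move=> H0 xS; have [r l] := walk_stepE x n.
have -> : history X x n.+1 = history X x n `&` step n (x n.+1).
  rewrite -history_extend; congr (history X _ _); apply/funext => i.
  by rewrite /extend; case: eqVneq => // ->.
have /andP[p0 p1] := right_probability_itv ((drift x n)%:~R : R).
by case: xS => ->; rewrite ?r ?l mulr_gt0 // subr_gt0.
Qed.

Lemma walk_start n : (n <= 50)%N -> 0 < fine (P (history X start n)).
Proof.
elim: n => [_|n IH n50].
  suff -> : history X start 0 = [set w | X 0%N w = 0] by case: walkX => ->.
  apply/seteqP; split => w /=; first exact.
  by move=> X0 i; rewrite leqn0 => /eqP ->.
apply: walk_follow; first exact/IH/ltnW.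
rewrite /start n50; case: ltnP => n50' /=.
  by case: (odd n) => /=; [right|left].
by left; have -> : n = 49%N by lia.
Qed.

Let follows k := history X start 50 `&`
  [set w | forall n, (50 <= n < 50 + k)%N -> obeys_drift (X^~ w) n].

Let followsS k : follows k.+1 =
  follows k `\`
  (history X start 50 `\` [set w | obeys_drift (X^~ w) (50 + k)%N]).
Proof.
apply/seteqP; split => w.
  move=> [H O]; split; first by split=> // n nk; apply: O; lia.
  by move=> -[_]; apply; apply: O; lia.
move=> [[H O] nO]; split=> // n; rewrite addnS ltnS => /andP[n50].
rewrite leq_eqVlt => /orP[/eqP ->|nk]; last by apply: O; rewrite n50.
by apply: contrapT => nO'; apply: nO.
Qed.

Let measurable_follows k : measurable (follows k).
Proof.
elim: k => [|k IH]; last first.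
  by rewrite followsS; have := measurable_obeys_drift X (50 + k); auto.
rewrite /follows (_ : [set w | _] = setT) ?setIT //.
by apply/seteqP; split=> // w _ n; lia.
Qed.

(** Union bound with a telescoping majorant: [4 / (m + 1)^2 <= 4 / m - 4 / (m + 1)]. *)
Let follows_ge k :
  (1 - 4 / 50 + 4 / (50 + k)%:R) * fine (P (history X start 50)) <=
    fine (P (follows k)).
Proof.
elim: k => [|k IH].
  rewrite addn0 subrK mul1r; apply: fine_probability_le => // w H.
  by split=> // n; lia.
have mO := measurable_obeys_drift X (50 + k).
rewrite followsS fine_probabilityD //; last exact: measurableD.
(* The violation is estimated given only the history up to time 50, so no conditioning on earlier
   obedience is required. *)
have Pb : fine (P (follows k `&` (history X start 50 `\`
    [set w | obeys_drift (X^~ w) (50 + k)%N]))) <=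
    slip R (50 + k) * fine (P (history X start 50)).
  apply: le_trans (walk_slip _ _) => //.
  by apply: fine_probability_le; auto => w [].
apply: le_trans (lerB IH Pb).
rewrite -mulrBl ler_wpM2r ?fine_probability_ge0 //.
rewrite /slip -!addrA !lerD2l -natr1 addnS -natr1; set a : R := (50 + k)%:R.
have a0 : 0 < a by rewrite ltr0n.
have a1 : 0 < a + 1 by lra.
rewrite -subr_ge0 (_ : _ - _ = 4 / (a * (a + 1) ^+ 2)).
  by rewrite divr_ge0 // mulr_ge0 ?exprn_ge0 // ltW.
by field; rewrite !gt_eqF.
Qed.

(** Continuity from above along [follows], whose probabilities stay above the fixed fraction
    [1 - 4 / 50] of that of the start. *)
Lemma walk_obeys_drift :
  (0 < P (history X start 50 `&`
    [set w | forall n, (50 <= n)%N -> obeys_drift (X^~ w) n]))%E.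
Proof.
have capE : \bigcap_k follows k = history X start 50 `&`
    [set w | forall n, (50 <= n)%N -> obeys_drift (X^~ w) n].
  apply/seteqP; split=> w.
    move=> F; split; first by case: (F 0%N).
    by move=> n n50; case: (F n.+1 I) => _; apply; lia.
  by move=> [H O] k _; split=> // n /andP[n50 _]; exact: O.
rewrite -capE.
have cv : (P \o follows) k @[k --> \oo] --> P (\bigcap_k follows k).
  apply: nonincreasing_cvg_mu => //.
  - by rewrite ltey_eq fin_num_measure.
  - exact: bigcapT_measurable.
  - apply/nonincreasing_seqP => k; rewrite followsS subsetEset.
    exact: subDsetl.
have H0 := walk_start (leqnn 50).
apply: (@lt_le_trans _ _ ((1 - 4 / 50) * fine (P (history X start 50)))%:E).
  by rewrite lte_fin mulr_gt0 //; lra.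
rewrite -(cvg_lim _ cv) //; apply: lime_ge.
  by apply/cvg_ex; eexists; exact: cv.
apply: nearW => k /=; rewrite -[leRHS]fineK ?fin_num_measure // lee_fin.
apply: le_trans (follows_ge k); rewrite ler_wpM2r ?fine_probability_ge0 //.
by rewrite lerDl divr_ge0.
Qed.

End Walk.

(** * Measurability of the convergence event and conclusion *)

Lemma measurable_cvg d (T : measurableType d) (R : realType)
    (f : nat -> T -> R) (l : R) : (forall n, measurable_fun setT (f n)) ->
  measurable [set w | f^~ w @ \oo --> l].
Proof.
move=> mf.
rewrite (_ : mkset _ = \bigcap_k \bigcup_N \bigcap_(n in [set n | (N <= n)%N])
    [set w | `|l - f n w| <= k.+1%:R^-1]).
  apply: bigcapT_measurable => k; apply: bigcupT_measurable => N.
  apply: bigcap_measurableType => n _.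
  move: (k.+1%:R^-1) => e.
  rewrite (_ : mkset _ = f n @^-1` [set` `[l - e, l + e]]).
    by rewrite -[X in measurable X]setTI; exact: mf.
  apply/seteqP; split => w /=; rewrite in_itv /= ler_norml => /andP[a b];
    apply/andP; split; lra.
apply/seteqP; split => w.
  move=> /cvgrPdist_le fl k _.
  have /fl[N _ fN] : 0 < k.+1%:R^-1 :> R by rewrite invr_gt0.
  by exists N => // n nN; exact: fN.
move=> fl; apply/cvgrPdist_le => e e0.
(* With [k] the integer part of [1 / e], one has [1 / (k + 1) < e]. *)
have [N _ fN] := fl (Num.truncn e^-1) I.
exists N => // n nN; apply: le_trans (fN n nN) _.
rewrite invf_ple ?posrE //; apply/ltW/truncnS_gt.
Qed.

Theorem proposition6 (R : realType) (d : measure_display)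
    (T : measurableType d) (P : probability T R)
    (X : nat -> {RV P >-> int})
    (walkX : self_interacting_walk X (fun=> 0)) :
  (0 < P [set w | (fun n : nat => (X n w)%:~R * ln 2 / ln n%:R)%R
                    @ \oo --> (1 : R)%R])%E.
Proof.
apply: lt_le_trans (walk_obeys_drift walkX) _.
(* Obeying the drift after the start forces convergence; monotonicity of [P] also asks that both
   events be measurable. *)
apply: le_measure; rewrite ?inE.
- apply: measurableI; first exact: measurable_history.
  rewrite (_ : mkset _ = \bigcap_(n in [set n | (50 <= n)%N])
    [set w | obeys_drift (X^~ w) n]) //.
  by apply: bigcap_measurableType => n _; exact: measurable_obeys_drift.
- apply: (measurable_cvg (f := fun n w => (X n w)%:~R * ln 2 / ln n%:R)) => n.
  move=> _ Y mY; rewrite setTI.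
  exact: (measurable_funPTI (X n)
    (Y := [set z : int | Y (z%:~R * ln 2 / ln n%:R)])).
- move=> w [H O]; apply: (cvg_log_ratio (c := 8 * ln 2) (N := 50)) => n n50.
  exact: (obeys_drift_log R H O).
Qed.
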